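(* Let $x$ and $y$ be nonzero vectors in a complex inner product space. Then, for every $\alpha\in\mathbb{R}$, we have $$\|x\|\|y\|\left(1 - \frac12 \left\|\frac{e^{i\alpha}x}{\|x\|}-\frac{y}{\|y\|}\right\|^2\right) \le |(x,y)| = \|x\|\|y\|\left(1 - \frac12 \left\|\frac{e^{ - i \operatorname{Arg} (x,y)} x}{\|x\|}-\frac{y}{\|y\|}\right\|^2\right).$$
   Context: The inner product $(x,y)$ is linear in the first argument and conjugate linear in the second, and $\|x\| = \sqrt{(x,x)}$. For $z\in\mathbb{C}$, $z\neq 0$, $\operatorname{Arg} z$ denotes the principal argument of $z$, that is, $0\le \operatorname{Arg} z<2\pi$ and, in polar coordinates, $z = e^{i \operatorname{Arg} z} r$ with $r=|z|$. The principal argument is chosen for definiteness; any other argument will do equally well. *)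

(* Defs.v *)
From mathcomp Require Export all_boot all_order all_algebra.
From mathcomp Require Export sesquilinear complex.
From mathcomp Require Export boolp classical_sets reals trigo.

Set Implicit Arguments.
Unset Strict Implicit.
Unset Printing Implicit Defensive.

Import Order.TTheory GRing.Theory Num.Theory.

Local Open Scope ring_scope.
Local Open Scope complex_scope.
Local Open Scope classical_set_scope.

(* e^{i t} for real t, through Euler's formula. *)
Definition expi (R : realType) (t : R) : R[i] := cos t +i* sin t.

(* 0 has every number as an argument, so Arg 0 is an unspecified element of
   [0, 2 pi[. *)
Definition Arg (R : realType) (z : R[i]) : R :=
  xget 0 [set t : R | 0 <= t < 2 * pi /\ z = expi t * `|z|].

(* A complex inner product on V is a form ip : {dot V for Num.conj}, linear in
   its first argument and conjugate linear in the second.  Its norm is taken in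
   R[i], like the library's modulus `|z|; there u <= v means that v - u is a
   nonnegative real. *)
Definition ipnorm (R : realType) (V : lmodType R[i])
    (ip : {dot V for (@Num.conj R[i])}) (x : V) : R[i] :=
  sqrtC (ip x x).

(* Main.v *)
(* For unit vectors u and v, 1 - ||u - v||^2 / 2 = Re (u, v).  With u = c x / ||x||,
   |c| = 1, and v = y / ||y||, multiplying by ||x|| ||y|| gives Re (c (x, y)),
   which is at most |(x, y)| and equals it for c = e^{- i Arg (x, y)}. *)
Require Import Defs.
From mathcomp Require Import ring lra.

Set Implicit Arguments.
Unset Strict Implicit.
Unset Printing Implicit Defensive.

Import Order.TTheory GRing.Theory Num.Theory.

Local Open Scope ring_scope.

Lemma normc_expi (R : realType) (t : R) : `|expi t| = 1.
Proof. by rewrite normc_def /= cos2Dsin2 sqrtr1. Qed.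

Lemma expiNM (R : realType) (t : R) : expi (- t) * expi t = 1.
Proof.
rewrite /expi cosN sinN; apply/eqP; rewrite eq_complex /=.
apply/andP; split; apply/eqP; last by ring.
by rewrite -(cos2Dsin2 t); ring.
Qed.

(** On the upper half circle the angle is [acos a], where the sine is nonnegative and so equals
    [|b|]. A point with [b < 0] is the mirror image of such a point, with angle [2 pi - acos a]. *)
Lemma expi_surj (R : realType) (w : R[i]) :
  `|w| = 1 -> exists2 t : R, 0 <= t < 2 * pi & w = expi t.
Proof.
case: w => a b /(congr1 (fun z : R[i] => z ^+ 2)).
rewrite expr1n -add_Re2_Im2 => /complexI /= ab1.
have aB : -1 <= a <= 1.
  rewrite -ler_norml -(@expr_le1 _ 2) // real_normK ?num_real //.
  by rewrite -ab1 lerDl sqr_ge0.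
have ac : cos (acos a) = a by apply: acosK; rewrite in_itv.
have as2 : sin (acos a) = `|b|.
  by rewrite sin_acos // -ab1 addrC addKr sqrtr_sqr.
have a0 : 0 <= acos a := acos_ge0 aB.
have api : acos a <= pi := acos_lepi aB.
have pi0 := pi_gt0 R.
have [b0|b0] := leP 0 b.
  exists (acos a); first by apply/andP; split; lra.
  by rewrite /expi ac as2 ger0_norm.
(* Strictness keeps [2 pi - acos a] below [2 pi]; it holds because [b < 0] forces [a < 1]. *)
have a_gt0 : 0 < acos a by apply: acos_gt0; nra.
exists (- acos a + pi *+ 2); first by apply/andP; split; lra.
by rewrite /expi cosD2pi sinD2pi cosN sinN ac as2 ltr0_norm // opprK.
Qed.

(** At 0 the modulus kills the arbitrary phase; elsewhere [expi_surj] at [z / |z|] shows that [xget]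
    chooses from a nonempty set. *)
Lemma expi_Arg (R : realType) (z : R[i]) : z = expi (Arg z) * `|z|.
Proof.
have [->|z0] := eqVneq z 0; first by rewrite normr0 mulr0.
suff [] : [set t : R | 0 <= t < 2 * pi /\ z = expi t * `|z|]%classic (Arg z).
  by [].
have nz0 : `|z| != 0 by rewrite normr_eq0.
have [|t tB zt] := @expi_surj R (z / `|z|).
  by rewrite normrM normfV normr_id divff.
by apply: xgetPex; exists t; split; rewrite // -zt divfK.
Qed.

Lemma ipnorm_unit_vectorsE (R : realType) (V : lmodType R[i])
    (ip : {dot V for (@Num.conj R[i])}) (x y : V) (c : R[i]) :
    x != 0 -> y != 0 -> `|c| = 1 ->
  ipnorm ip x * ipnorm ip y *
    (1 - 2^-1 * ipnorm ip ((ipnorm ip x)^-1 *: (c *: x) -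
                           (ipnorm ip y)^-1 *: y) ^+ 2)
  = 'Re (c * ip x y).
Proof.
move=> x0 y0 c1.
have nx : 0 < ipnorm ip x by rewrite sqrt_dnorm_gt0.
have ny : 0 < ipnorm ip y by rewrite sqrt_dnorm_gt0.
(* Norms are elements of [R[i]], so scalars leaving the second argument get conjugated; positivity
   makes these ones real. *)
have conj_inv (v : V) : 0 < ipnorm ip v ->
    ((ipnorm ip v)^-1)^* = (ipnorm ip v)^-1.
  by move=> nv; rewrite conj_Creal // realV gtr0_real.
have unit_norm (v : V) : 0 < ipnorm ip v ->
    `|(ipnorm ip v)^-1| ^+ 2 * ip v v = 1.
  move=> nv; rewrite ger0_norm ?invr_ge0 ?ltW // -[ip v v]sqrtCK -exprMn.
  by rewrite mulVf ?expr1n ?gt_eqF.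
(* Expanding the squared norm of the difference leaves two unit squares, which cancel the leading 1,
   and a cross term plus its conjugate, which is twice a real part. *)
rewrite [X in _ * X ^+ 2]/ipnorm sqrtCK dnormB !dnormZ c1 expr1n mul1r.
rewrite !unit_norm // !linearZl_LR linearZr_LR /= !conj_inv //.
rewrite !rmorphM /= !conj_inv // ReE rmorphM.
by field; rewrite !gt_eqF.
Qed.

Theorem theorem2p3 (R : realType) (V : lmodType R[i])
    (ip : {dot V for (@Num.conj R[i])}) (x y : V)
    (hx : x != 0) (hy : y != 0) (alpha : R) :
  ipnorm ip x * ipnorm ip y *
    (1 - 2^-1 *
       ipnorm ip ((ipnorm ip x)^-1 *: (expi alpha *: x) -
                  (ipnorm ip y)^-1 *: y) ^+ 2)
    <= `|ip x y|
  /\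
  `|ip x y| =
  ipnorm ip x * ipnorm ip y *
    (1 - 2^-1 *
       ipnorm ip ((ipnorm ip x)^-1 *: (expi (- Arg (ip x y)) *: x) -
                  (ipnorm ip y)^-1 *: y) ^+ 2).
Proof.
split.
  rewrite ipnorm_unit_vectorsE ?normc_expi //.
  (* A unit phase put inside the modulus makes both sides speak of the same number, whose real part
     is at most its modulus. *)
  rewrite -[leRHS]mul1r -(normc_expi alpha) -normrM.
  apply: le_trans (real_ler_norm (Creal_Re _)) _.
  exact: leif_normC_Re_Creal.
rewrite ipnorm_unit_vectorsE ?normc_expi //.
(* Only the factor outside the phase is put in polar form; the two phases then cancel and leave a
   modulus, which is its own real part. *)
rewrite [X in expi _ * X]expi_Arg.
rewrite mulrA expiNM mul1r.
by apply/esym/Creal_ReP/normr_real.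
Qed.
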